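(* Let $d\in\mathbb N_0$, let $(P_n)_{n\ge 0}$ be the Pell sequence, and let $A_d=(a_{i,j})_{i,j=1}^{d+1}$ be the $(d+1)\times(d+1)$ matrix defined by $$a_{i,j}=\begin{cases}0 & \text{if } i>j,\\ 2 & \text{if } i=j,\\ (2^{j-i}+2)\binom{j-1}{i-1} & \text{if } i<j.\end{cases}$$ The matrix $A_d$ is invertible, with determinant $2^{d+1}\neq 0$, and therefore there exists a unique $(d+1)$-tuple $(\lambda_0(d),\lambda_1(d),\ldots,\lambda_d(d))\in\mathbb R^{d+1}$ solving the matrix equation $$A_d\,(\lambda_0(d),\lambda_1(d),\ldots,\lambda_d(d))^T = 2\left(\binom{d}{0}2^d,\binom{d}{1}2^{d-1},\ldots,\binom{d}{d}2^0\right)^T.$$ Then the polynomials $F(x),G(x),H(x)$ defined by $$F(x)=\sum_{i=0}^{d}\lambda_i(d)x^i,\qquad G(x)=-2(x+1)^d+\sum_{i=0}^{d}\lambda_i(d)(x+1)^i,\qquad H(x)=2^{d+1}-\sum_{i=0}^{d}(2^i+2)\lambda_i(d)$$ ($H$ is a constant polynomial) satisfy, for all $n\in\mathbb N$, $$2\sum_{k=1}^{n}k^dP_{k-1}=F(n)P_{n+1}+G(n)P_n+H(n).$$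
   Context: $\mathbb N$ denotes the positive integers and $\mathbb N_0=\mathbb N\cup\{0\}$. The Pell sequence $(P_n)_{n\ge0}$ is defined by $P_0=0$, $P_1=1$, $P_{k+2}=2P_{k+1}+P_k$ for all $k\ge 0$. *)

(* Defs.v *)
From HB Require Import structures.
From mathcomp Require Import all_boot all_order all_algebra.
From mathcomp Require Import reals.
Set Implicit Arguments.
Unset Strict Implicit.
Unset Printing Implicit Defensive.
Import Order.TTheory GRing.Theory Num.Theory.
Local Open Scope ring_scope.

Fixpoint pell (n : nat) : nat :=
  match n with
  | 0 => 0
  | 1 => 1
  | (m.+1 as k).+1 => 2 * pell k + pell m
  end%N.

(* The entry a_(i,j), with 1-based indices i and j. *)
Definition pell_coef (R : realType) (i j : nat) : R :=
  if (j < i)%N then 0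
  else if i == j then 2
  else (2 ^+ (j - i) + 2) * 'C(j.-1, i.-1)%:R.

(* Ordinals are 0-based, hence the shift by one in both indices. *)
Definition pell_mx (R : realType) (d : nat) : 'M[R]_d.+1 :=
  \matrix_(i, j) pell_coef R i.+1 j.+1.

Definition pell_rhs (R : realType) (d : nat) : 'cV[R]_d.+1 :=
  2 *: \col_i ('C(d, i)%:R * 2 ^+ (d - i)).

Definition polyF (R : realType) (d : nat) (lam : 'cV[R]_d.+1) : {poly R} :=
  \sum_(i < d.+1) lam i 0 *: 'X^i.

Definition polyG (R : realType) (d : nat) (lam : 'cV[R]_d.+1) : {poly R} :=
  - 2 *: ('X + 1) ^+ d + \sum_(i < d.+1) lam i 0 *: ('X + 1) ^+ i.

Definition polyH (R : realType) (d : nat) (lam : 'cV[R]_d.+1) : {poly R} :=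
  (2 ^+ d.+1 - \sum_(i < d.+1) (2 ^+ i + 2) * lam i 0)%:P.

(* Main.v *)
(* Row [i] of the system compares the coefficients of [x^i] in
     F(x + 2) + 2 F(x + 1) - F(x) = 2 (x + 2)^d.
   As G(x) = F(x + 1) - 2 (x + 1)^d, this is exactly what makes the increment of
   F(n) P_(n+1) + G(n) P_n equal to 2 (n + 1)^d P_n; at x = 0 it reads F(0) + H = 0,
   which is the identity for n = 0, so induction may start there. *)
Require Import Defs.
From HB Require Import structures.
From mathcomp Require Import all_boot all_order all_algebra.
From mathcomp Require Import reals.
From mathcomp Require Import ring.
Set Implicit Arguments.
Unset Strict Implicit.
Unset Printing Implicit Defensive.
Import Order.TTheory GRing.Theory Num.Theory.
Local Open Scope ring_scope.

Lemma pellSS (n : nat) : pell n.+2 = (2 * pell n.+1 + pell n)%N.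
Proof. by []. Qed.

(** [pell_mx] is upper triangular with diagonal entries 2; [det_trig] expects a lower triangular
    matrix, hence the transpose. *)
Lemma det_pell_mx (R : realType) (d : nat) : \det (pell_mx R d) = 2 ^+ d.+1.
Proof.
rewrite -det_tr det_trig.
  rewrite (eq_bigr (fun=> 2)) ?prodr_const ?card_ord // => i _.
  by rewrite !mxE /pell_coef ltnn eqxx.
by apply/is_trig_mxP => i j lt_ij; rewrite !mxE /pell_coef ltnS lt_ij.
Qed.

(** Terms with [i > j] vanish since ['C(j, i) = 0], whatever the truncated exponent. A range
    independent of [j] lets expansions of different degrees be added and their sums exchanged. *)
Lemma exprDn_widen (R : comNzRingType) (d j : nat) (x y : R) : (j <= d)%N ->
  (x + y) ^+ j = \sum_(i < d.+1) y ^+ (j - i) * 'C(j, i)%:R * x ^+ i.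
Proof.
move=> le_jd; rewrite addrC exprDn.
rewrite (big_ord_widen d.+1 (fun i => y ^+ (j - i) * x ^+ i *+ 'C(j, i))) //.
rewrite big_mkcond; apply: eq_bigr => i _.
case: ifPn => [_|]; first by rewrite -mulr_natr; ring.
by rewrite -leqNgt => lt_ji; rewrite bin_small // mulr0 mul0r.
Qed.

(** Column [j] lists the coefficients of the image of [x ^+ j] under the operator f(x + 2) + 2 f(x +
    1) - f(x). *)
Lemma pell_mx_colE (R : realType) (d : nat) (j : 'I_d.+1) (x : R) :
  (x + 2) ^+ j + 2 * (x + 1) ^+ j - x ^+ j = \sum_(i < d.+1) pell_mx R d i j * x ^+ i.
Proof.
have le_jd : (j <= d)%N by rewrite -ltnS.
rewrite (exprDn_widen x 2 le_jd) (exprDn_widen x 1 le_jd) mulr_sumr -big_split /=.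
(* The term [- x ^+ j] affects only [i = j], where the coefficient becomes 1 + 2 - 1 = 2. *)
rewrite (bigD1 j) //= [RHS](bigD1 j) //= addrAC; congr (_ + _).
  by rewrite mxE /pell_coef ltnn eqxx subnn binn !expr0; ring.
apply: eq_bigr => i ne_ij; rewrite mxE /pell_coef ltnS eqSS (negbTE (ne_ij : i != j :> nat)).
rewrite subSS expr1n; case: ltnP => [lt_ji|_] /=; last by ring.
by rewrite bin_small //; ring.
Qed.

Lemma pell_system_poly (R : realType) (d : nat) (lam : 'cV[R]_d.+1) (x : R) :
    pell_mx R d *m lam = pell_rhs R d ->
  (polyF lam).[x + 2] + 2 * (polyF lam).[x + 1] - (polyF lam).[x] = 2 * (x + 2) ^+ d.
Proof.
move=> sys; have FE y : (polyF lam).[y] = \sum_(i < d.+1) lam i 0 * y ^+ i.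
  by rewrite horner_sum; apply: eq_bigr => i _; rewrite !hornerE.
rewrite !FE mulr_sumr -big_split -sumrB /=.
transitivity (\sum_(j < d.+1) \sum_(i < d.+1) pell_mx R d i j * lam j 0 * x ^+ i).
  apply: eq_bigr => j _; transitivity (lam j 0 * \sum_i pell_mx R d i j * x ^+ i).
    by rewrite -pell_mx_colE; ring.
  by rewrite mulr_sumr; apply: eq_bigr => i _; ring.
(* After the exchange, the coefficient of [x ^+ i] is row [i] of [pell_mx R d *m lam]. *)
rewrite exchange_big (exprDn_widen x 2 (leqnn d)) mulr_sumr; apply: eq_bigr => i _ /=.
have := congr1 (fun M : 'cV_d.+1 => M i 0) sys; rewrite !mxE -mulr_suml => ->.
by ring.
Qed.

Lemma polyG_horner (R : realType) (d : nat) (lam : 'cV[R]_d.+1) (x : R) :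
  (polyG lam).[x] = (polyF lam).[x + 1] - 2 * (x + 1) ^+ d.
Proof.
rewrite hornerD !horner_sum addrC hornerZ horner_exp !hornerE mulNr.
congr (_ - _); apply: eq_bigr => i _.
by rewrite !hornerZ horner_exp !hornerE.
Qed.

(** The weight [2 ^+ i + 2] is [2 ^+ i + 2 * 1 ^+ i], so the sum combines the values of F at 2 and
    1. *)
Lemma polyH_horner (R : realType) (d : nat) (lam : 'cV[R]_d.+1) (x : R) :
  (polyH lam).[x] = 2 ^+ d.+1 - ((polyF lam).[2] + 2 * (polyF lam).[1]).
Proof.
rewrite hornerC !horner_sum mulr_sumr -big_split /=; congr (_ - _).
by apply: eq_bigr => i _; rewrite !hornerZ !hornerXn expr1n; ring.
Qed.

Lemma pell_sum (R : realType) (d : nat) (lam : 'cV[R]_d.+1) (n : nat) :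
    pell_mx R d *m lam = pell_rhs R d ->
  2 * \sum_(1 <= k < n.+1) k%:R ^+ d * (pell k.-1)%:R
  = (polyF lam).[n%:R] * (pell n.+1)%:R + (polyG lam).[n%:R] * (pell n)%:R
    + (polyH lam).[n%:R].
Proof.
move=> sys; elim: n => [|n IHn].
  have := pell_system_poly 0 sys; rewrite !add0r => F0.
  by rewrite big_geq // polyH_horner exprS -F0 /=; ring.
rewrite big_nat_recr // mulrDr IHn succnK !polyH_horner !polyG_horner.
have := pell_system_poly n%:R sys.
have -> : n.+1%:R + 1 = n%:R + 2 :> R by rewrite -(natr1 n); ring.
(* The functional equation at n is solved for F(n + 2), so G(n + 1) becomes F(n) - 2 F(n + 1); the
   term -2 F(n + 1) P_(n+1) then cancels against the one from P_(n+2) = 2 P_(n+1) + P_n. *)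
rewrite -!(natr1 n) => /(canRL (subrK _)) /(canRL (addrK _)) ->.
by rewrite pellSS natrD natrM; ring.
Qed.

Theorem theorem1p2 (R : realType) (d : nat) :
  [/\ pell_mx R d \in unitmx,
      \det (pell_mx R d) = 2 ^+ d.+1,
      (2 ^+ d.+1 : R) != 0,
      exists! lam : 'cV[R]_d.+1, pell_mx R d *m lam = pell_rhs R d
    & forall lam : 'cV[R]_d.+1, pell_mx R d *m lam = pell_rhs R d ->
      forall n : nat, (0 < n)%N ->
        2 * \sum_(1 <= k < n.+1) k%:R ^+ d * (pell k.-1)%:R
        = (polyF lam).[n%:R] * (pell n.+1)%:R
          + (polyG lam).[n%:R] * (pell n)%:R
          + (polyH lam).[n%:R]].
Proof.
have det_neq0 : (2 ^+ d.+1 : R) != 0 by rewrite expf_neq0 // pnatr_eq0.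
have unitA : pell_mx R d \in unitmx by rewrite unitmxE det_pell_mx unitfE.
split=> //; first exact: det_pell_mx.
  exists (invmx (pell_mx R d) *m pell_rhs R d); split; first by rewrite mulKVmx.
  by move=> lam <-; rewrite mulKmx.
by move=> lam sys n _; exact: pell_sum.
Qed.
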